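(* Let $\Bbbk$ be an algebraically closed field, let $Q$ be a finite connected quiver which is not a single vertex without arrows, and let $A=\Bbbk Q/I$ with $I$ an admissible ideal (so $A$ is a connected finite dimensional algebra). Let $\Delta:A\to A\otimes_{\Bbbk} A$ be a nearly Frobenius structure on $A$ with handle element $\omega=m(\Delta(1))$. Then $\omega\in J$, where $J$ is the Jacobson radical of $A$.
   Context: For a finite quiver $Q$, $\Bbbk Q$ is its path algebra; an ideal $I\subset \Bbbk Q$ is admissible if there is $k\ge 2$ with $F^k\subset I\subset F^2$, where $F$ is the ideal of $\Bbbk Q$ generated by all arrows. A nearly Frobenius structure on an associative unital $\Bbbk$-algebra $A$ is a homomorphism of $A$-bimodules $\Delta: A\to A\otimes_{\Bbbk} A$, where $a\cdot(x\otimes y)\cdot b=ax\otimes yb$. Here $m:A\otimes_{\Bbbk} A\to A$ is the multiplication, and the handle element of $(A,\Delta)$ is $m(\Delta(1))\in A$. *)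

(* Defs.v *)
From HB Require Import structures.
From mathcomp Require Import all_boot all_algebra.
From mathcomp Require Import generic_quotient ring_quotient finmap.
From mathcomp Require Import boolp classical_sets.
From mathcomp Require Import monalg.

Set Implicit Arguments.
Unset Strict Implicit.
Unset Printing Implicit Defensive.

Import GRing.Theory.

Local Open Scope classical_set_scope.
Local Open Scope ring_scope.

Section Extend.
Variables (k : fieldType) (K : choiceType) (V : lmodType k).

Definition mextend (f : K -> V) (g : {malg k[K]}) : V :=
  \sum_(x <- msupp g) g@_x *: f x.

Lemma mextendw f g (D : {fset K}) : (msupp g `<=` D)%fset ->
  mextend f g = \sum_(x <- D) g@_x *: f x.
Proof.
move=> le_gD; apply: big_fset_incl => // x _ /mcoeff_outdom ->.
by rewrite scale0r.
Qed.

Lemma mextend_is_linear f : linear (mextend f).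
Proof.
move=> a g h; pose D := (msupp (a *: g + h) `|` msupp g `|` msupp h)%fset.
have sub1 : (msupp (a *: g + h) `<=` D)%fset.
  by apply/fsubsetP => x; rewrite !in_fsetU => ->.
have sub2 : (msupp g `<=` D)%fset.
  by apply/fsubsetP => x; rewrite !in_fsetU => ->; rewrite orbT.
have sub3 : (msupp h `<=` D)%fset.
  by apply/fsubsetP => x; rewrite !in_fsetU => ->; rewrite orbT.
rewrite (mextendw _ sub1) (mextendw _ sub2) (mextendw _ sub3).
rewrite scaler_sumr -big_split /=; apply: eq_bigr => x _.
by rewrite mcoeffD mcoeffZ scalerDl scalerA.
Qed.

HB.instance Definition _ f :=
  GRing.isLinear.Build k {malg k[K]} V *:%R (mextend f) (mextend_is_linear f).

Lemma mextendU f x : mextend f << x >> = f x.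
Proof.
rewrite (mextendw _ (msuppU_le (x := 1))) big_seq_fset1 mcoeffUU.
by rewrite scale1r.
Qed.

End Extend.

Lemma malg_scaleU (k : fieldType) (K : choiceType) (a : k) (x : K) :
  << a *g x >> = a *: << x >> :> {malg k[K]}.
Proof.
by apply/malgP => y; rewrite mcoeffZ !mcoeffU mulrnAr mulr1.
Qed.

Lemma malg_lin_ext (k : fieldType) (K : choiceType) (V : lmodType k)
  (f g : {malg k[K]} -> V) : linear f -> linear g ->
  (forall x, f << x >> = g << x >>) -> f =1 g.
Proof.
move=> lf lg fg u.
pose F := GRing.isLinear.Build k {malg k[K]} V *:%R f lf.
pose G := GRing.isLinear.Build k {malg k[K]} V *:%R g lg.
pose f' : {linear {malg k[K]} -> V} := HB.pack f F.
pose g' : {linear {malg k[K]} -> V} := HB.pack g G.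
rewrite -[f]/(f' : _ -> _) -[g]/(g' : _ -> _) [u]monalgE !linear_sum.
by apply: eq_bigr => x _; rewrite malg_scaleU !linearZ /= fg.
Qed.

Record submodule (k : fieldType) (M : lmodType k) := Submodule {
  submod_set :> set M;
  submod0 : submod_set 0;
  submodD : forall x y, submod_set x -> submod_set y -> submod_set (x + y);
  submodZ : forall a x, submod_set x -> submod_set (a *: x)
}.

Section Kernel.
Variables (k : fieldType) (M N : lmodType k) (f : {linear M -> N}).

Fact lker_submodD x y : f x = 0 -> f y = 0 -> f (x + y) = 0.
Proof. by rewrite linearD => -> ->; rewrite addr0. Qed.

Fact lker_submodZ a x : f x = 0 -> f (a *: x) = 0.
Proof. by rewrite linearZ /= => ->; rewrite scaler0. Qed.

Definition lker_submodule : submodule M :=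
  @Submodule k M [set x | f x = 0] (linear0 f) lker_submodD lker_submodZ.

End Kernel.

Section QuotientModule.
Variables (k : fieldType) (M : lmodType k) (S : submodule M).

(* `ring_quotient' takes boolean predicates, hence the classical `[< >]. *)
Definition submod_pred : M -> bool := fun x => `[< submod_set S x >].

Fact submod_pred_closed : zmod_closed submod_pred.
Proof.
split; first by apply/asboolP; exact: submod0.
move=> x y /asboolP Sx /asboolP Sy; apply/asboolP.
by rewrite -scaleN1r; apply: submodD => //; exact: submodZ.
Qed.

HB.instance Definition _ :=
  GRing.isZmodClosed.Build M submod_pred submod_pred_closed.

Definition submod_closed := GRing.ZmodClosed.clone M submod_pred _.

Definition mquot := Quotient.quot submod_closed.

HB.instance Definition _ := GRing.Zmodule.on mquot.

Definition mproj (x : M) : mquot := \pi_(Quotient.quot submod_closed)%qT x.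

Lemma mproj_eq x y : mproj x = mproj y <-> submod_set S (x - y).
Proof.
split=> [e|Sxy].
  have /eqP := e; rewrite -Quotient.idealrBE => /asboolP; exact.
by apply/eqP; rewrite -Quotient.idealrBE; apply/asboolP.
Qed.

Definition mrepr (u : mquot) : M := repr u.

Lemma mreprK u : mproj (mrepr u) = u.
Proof. exact: reprK. Qed.

Lemma mrepr_proj x : submod_set S (mrepr (mproj x) - x).
Proof. by apply/mproj_eq; rewrite mreprK. Qed.

Lemma mprojB : zmod_morphism mproj.
Proof.
move=> x y; exact: (raddfB (\pi_(Quotient.quot submod_closed)%qT)).
Qed.

HB.instance Definition _ := GRing.isZmodMorphism.Build M mquot mproj mprojB.

Definition mquot_scale (a : k) (u : mquot) : mquot := mproj (a *: mrepr u).

Lemma mproj_scale a x : mquot_scale a (mproj x) = mproj (a *: x).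
Proof.
by apply/mproj_eq; rewrite -scalerBr; apply: submodZ; exact: mrepr_proj.
Qed.

Fact mquot_scalerA a b u :
  mquot_scale a (mquot_scale b u) = mquot_scale (a * b) u.
Proof. by rewrite -[u]mreprK !mproj_scale scalerA. Qed.

Fact mquot_scale1r : left_id 1 mquot_scale.
Proof. by move=> u; rewrite -[u]mreprK !mproj_scale scale1r. Qed.

Fact mquot_scalerDr : right_distributive mquot_scale +%R.
Proof.
move=> a u v; rewrite -[u]mreprK -[v]mreprK -raddfD !mproj_scale.
by rewrite scalerDr raddfD.
Qed.

Fact mquot_scalerDl u : {morph mquot_scale^~ u : a b / a + b}.
Proof.
by move=> a b /=; rewrite -[u]mreprK !mproj_scale scalerDl raddfD.
Qed.

HB.instance Definition _ := GRing.Zmodule_isLmodule.Build k mquot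
  mquot_scalerA mquot_scale1r mquot_scalerDr mquot_scalerDl.

Lemma mprojZ : scalable mproj.
Proof. by move=> a x; rewrite -mproj_scale. Qed.

HB.instance Definition _ :=
  GRing.isScalable.Build k M mquot *:%R mproj mprojZ.

End QuotientModule.

Section Ideals.
Variables (k : fieldType) (A : algType k).
Implicit Types (I J S : set A).

Definition left_ideal I : Prop :=
  [/\ I 0, (forall x y, I x -> I y -> I (x + y))
    & (forall a x, I x -> I (a * x))].

Definition two_sided_ideal I : Prop :=
  left_ideal I /\ (forall x a, I x -> I (x * a)).

Definition maximal_left_ideal I : Prop :=
  [/\ left_ideal I, I <> setT
    & forall J, left_ideal J -> I `<=` J -> J = I \/ J = setT].

Definition jacobson_radical : set A :=
  [set x | forall I, maximal_left_ideal I -> I x].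

Definition ideal_gen S : set A :=
  [set x | forall I, two_sided_ideal I -> S `<=` I -> I x].

Definition ideal_mul I J : set A :=
  [set x | exists s : seq (A * A),
     (forall p, p \in s -> I p.1 /\ J p.2) /\ x = \sum_(p <- s) p.1 * p.2].

Fixpoint ideal_pow I n : set A :=
  if n is m.+1 then ideal_mul (ideal_pow I m) I else setT.

Lemma ideal_gen_ideal S : two_sided_ideal (ideal_gen S).
Proof.
split; first split.
- by move=> I [[]].
- move=> x y Sx Sy I II SI; have [[_ ID _] _] := II.
  by apply: ID; [exact: Sx | exact: Sy].
- by move=> a x Sx I II SI; have [[_ _ IM] _] := II; apply: IM; exact: Sx.
- by move=> x a Sx I II SI; have [_ IM] := II; apply: IM; exact: Sx.
Qed.

Fact ideal_submod0 I : two_sided_ideal I -> I 0.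
Proof. by case=> [[]]. Qed.

Fact ideal_submodD I : two_sided_ideal I ->
  forall x y, I x -> I y -> I (x + y).
Proof. by case=> [[]]. Qed.

Fact ideal_submodZ I : two_sided_ideal I -> forall a x, I x -> I (a *: x).
Proof.
by move=> [[_ _ IM] _] a x Ix; rewrite -[x]mul1r scalerAl; exact: IM.
Qed.

(* Properness is what makes the quotient a nonzero ring, as `algType' wants. *)
Record proper_ideal2 := ProperIdeal2 {
  pideal_set :> set A;
  pideal_ideal : two_sided_ideal pideal_set;
  pideal_proper : ~ pideal_set 1
}.

Definition pideal_submod (I : proper_ideal2) : submodule A :=
  Submodule (ideal_submod0 (pideal_ideal I)) (ideal_submodD (pideal_ideal I))
    (ideal_submodZ (pideal_ideal I)).

End Ideals.

Arguments jacobson_radical {k} A.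

Section QuotientAlgebra.
Variables (k : fieldType) (A : algType k) (I : proper_ideal2 A).

Definition aquot := mquot (pideal_submod I).

HB.instance Definition _ := GRing.Lmodule.on aquot.

Definition aproj (x : A) : aquot := mproj (pideal_submod I) x.

Lemma aproj_is_linear : linear aproj.
Proof. exact: linearP. Qed.

HB.instance Definition _ :=
  GRing.isLinear.Build k A aquot *:%R aproj aproj_is_linear.

Definition arepr (u : aquot) : A := mrepr u.

Lemma areprK u : aproj (arepr u) = u.
Proof. exact: mreprK. Qed.

Lemma aproj_eq x y : aproj x = aproj y <-> pideal_set I (x - y).
Proof. exact: (mproj_eq (pideal_submod I)). Qed.

Definition aquot_mul (u v : aquot) : aquot := aproj (arepr u * arepr v).

Lemma aproj_mul x y : aquot_mul (aproj x) (aproj y) = aproj (x * y).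
Proof.
have [[_ ID IMl] IMr] := pideal_ideal I.
apply/aproj_eq; set x' := arepr _; set y' := arepr _.
have -> : x' * y' - x * y = x' * (y' - y) + (x' - x) * y.
  by rewrite mulrBr mulrBl addrA subrK.
by apply: ID; [apply: IMl | apply: IMr]; apply/aproj_eq; exact: areprK.
Qed.

Fact aquot_mulA : associative aquot_mul.
Proof.
move=> u v w; rewrite -[u]areprK -[v]areprK -[w]areprK !aproj_mul.
by rewrite mulrA.
Qed.

Fact aquot_mul1r : left_id (aproj 1) aquot_mul.
Proof. by move=> u; rewrite -[u]areprK aproj_mul mul1r. Qed.

Fact aquot_mulr1 : right_id (aproj 1) aquot_mul.
Proof. by move=> u; rewrite -[u]areprK aproj_mul mulr1. Qed.

Fact aquot_mulDl : left_distributive aquot_mul +%R.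
Proof.
move=> u v w; rewrite -[u]areprK -[v]areprK -[w]areprK -raddfD !aproj_mul.
by rewrite mulrDl raddfD.
Qed.

Fact aquot_mulDr : right_distributive aquot_mul +%R.
Proof.
move=> u v w; rewrite -[u]areprK -[v]areprK -[w]areprK -raddfD !aproj_mul.
by rewrite mulrDr raddfD.
Qed.

Fact aquot_oner_neq0 : aproj 1 != 0.
Proof.
apply/eqP; rewrite -(raddf0 aproj) => /aproj_eq; rewrite subr0.
exact: pideal_proper.
Qed.

HB.instance Definition _ := GRing.Zmodule_isNzRing.Build aquot
  aquot_mulA aquot_mul1r aquot_mulr1 aquot_mulDl aquot_mulDr aquot_oner_neq0.

Lemma aproj_monoid_morphism : monoid_morphism aproj.
Proof. by split=> // x y; rewrite -aproj_mul. Qed.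

HB.instance Definition _ :=
  GRing.isMonoidMorphism.Build A aquot aproj aproj_monoid_morphism.

Fact aquot_scalerAl (a : k) (u v : aquot) : a *: (u * v) = (a *: u) * v.
Proof.
rewrite -[u]areprK -[v]areprK -rmorphM -!linearZ /= -rmorphM.
by rewrite scalerAl.
Qed.

HB.instance Definition _ :=
  GRing.Lmodule_isLalgebra.Build k aquot aquot_scalerAl.

Fact aquot_scalerAr (a : k) (u v : aquot) : a *: (u * v) = u * (a *: v).
Proof.
rewrite -[u]areprK -[v]areprK -rmorphM -!linearZ /= -rmorphM.
by rewrite scalerAr.
Qed.

HB.instance Definition _ :=
  GRing.Lalgebra_isAlgebra.Build k aquot aquot_scalerAr.

End QuotientAlgebra.

Section Tensor.
Variables (k : fieldType) (V W : lmodType k).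
Local Notation free := {malg k[(V * W)%type]}.
Local Notation gen v w := (<< (v, w) >> : free).

Inductive tensor_rel : free -> Prop :=
| TensorDl v v' w : tensor_rel (gen (v + v') w - gen v w - gen v' w)
| TensorDr v w w' : tensor_rel (gen v (w + w') - gen v w - gen v w')
| TensorZl a v w : tensor_rel (gen (a *: v) w - a *: gen v w)
| TensorZr a v w : tensor_rel (gen v (a *: w) - a *: gen v w).

Definition tensor_null : set free :=
  [set x | forall S : submodule free, tensor_rel `<=` S -> submod_set S x].

Fact tensor_null0 : tensor_null 0.
Proof. by move=> S _; exact: submod0. Qed.

Fact tensor_nullD x y : tensor_null x -> tensor_null y -> tensor_null (x + y).
Proof. by move=> nx ny S sS; apply: submodD; [exact: nx | exact: ny]. Qed.

Fact tensor_nullZ a x : tensor_null x -> tensor_null (a *: x).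
Proof. by move=> nx S sS; apply: submodZ; exact: nx. Qed.

Definition tensor_submod := Submodule tensor_null0 tensor_nullD tensor_nullZ.

Definition tensor := mquot tensor_submod.

HB.instance Definition _ := GRing.Lmodule.on tensor.

End Tensor.

HB.lock Definition tens (k : fieldType) (V W : lmodType k) (v : V) (w : W) :
  tensor V W := mproj (tensor_submod V W) << (v, w) >>.

Arguments tens {k V W} v w.

Section TensorTheory.
Variables (k : fieldType) (V W : lmodType k).
Local Notation free := {malg k[(V * W)%type]}.
Local Notation tensor := (tensor V W).
Local Notation tensor_submod := (tensor_submod V W).
Local Notation tensor_rel := (@tensor_rel k V W).
Local Notation tens := (@tens k V W).

Lemma tensor_rel0 x : tensor_rel x -> mproj tensor_submod x = 0.
Proof.
move=> rx; rewrite -(raddf0 (mproj tensor_submod)); apply/mproj_eq.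
by rewrite subr0 => S; exact.
Qed.

Lemma tensDl v v' w : tens (v + v') w = tens v w + tens v' w.
Proof.
rewrite tens.unlock; apply/eqP; rewrite -subr_eq0 opprD addrA -!raddfB /=.
by rewrite tensor_rel0 //; exact: TensorDl.
Qed.

Lemma tensDr v w w' : tens v (w + w') = tens v w + tens v w'.
Proof.
rewrite tens.unlock; apply/eqP; rewrite -subr_eq0 opprD addrA -!raddfB /=.
by rewrite tensor_rel0 //; exact: TensorDr.
Qed.

Lemma tensZl a v w : tens (a *: v) w = a *: tens v w.
Proof.
rewrite tens.unlock; apply/eqP; rewrite -subr_eq0 -linearZ -raddfB /=.
by rewrite tensor_rel0 //; exact: TensorZl.
Qed.

Lemma tensZr a v w : tens v (a *: w) = a *: tens v w.
Proof.
rewrite tens.unlock; apply/eqP; rewrite -subr_eq0 -linearZ -raddfB /=.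
by rewrite tensor_rel0 //; exact: TensorZr.
Qed.

Section Lift.
Variables (U : lmodType k) (f : V -> W -> U).

(* The linear map induced by f; meaningful only for f bilinear. *)
Definition tens_lift (t : tensor) : U :=
  mextend (fun p => f p.1 p.2) (mrepr t).

Hypotheses (linl : forall w, linear (f^~ w)) (linr : forall v, linear (f v)).

Let ext : {linear free -> U} := mextend (fun p => f p.1 p.2).

Lemma tens_lift_proj x :
  tens_lift (mproj tensor_submod x) = mextend (fun p => f p.1 p.2) x.
Proof.
pose K := lker_submodule ext.
have addl w : {morph f^~ w : v v' / v + v'}.
  by move=> v v'; have := linl w 1 v v'; rewrite !scale1r.
have addr v : {morph f v : w w' / w + w'}.
  by move=> w w'; have := linr v 1 w w'; rewrite !scale1r.
have f0l w : f 0 w = 0.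
  by have /eqP := addl w 0 0; rewrite addr0 -subr_eq subrr => /eqP <-.
have f0r v : f v 0 = 0.
  by have /eqP := addr v 0 0; rewrite addr0 -subr_eq subrr => /eqP <-.
have sub : tensor_rel `<=` K.
  move=> _ [v v' w|v w w'|a v w|a v w] /=; rewrite /ext ?linearB ?linearZ /=;
    rewrite !mextendU /=.
  - by rewrite addl addrAC addrK subrr.
  - by rewrite addr addrAC addrK subrr.
  - by have := linl w a v 0; rewrite /= !addr0 f0l addr0 => ->; rewrite scalerN subrr.
  - by have := linr v a w 0; rewrite !addr0 f0r addr0 => ->; rewrite scalerN subrr.
have := mrepr_proj tensor_submod x => /(_ K sub) /eqP.
by rewrite /= linearB subr_eq0 => /eqP.
Qed.

Lemma tens_liftE v w : tens_lift (tens v w) = f v w.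
Proof. by rewrite tens.unlock tens_lift_proj mextendU. Qed.

Lemma tens_lift_linear : linear tens_lift.
Proof.
move=> a t u; rewrite -[t]mreprK -[u]mreprK -linearP !tens_lift_proj.
exact: mextend_is_linear.
Qed.

End Lift.

Lemma tens_lin_ext (U : lmodType k) (f g : tensor -> U) :
  linear f -> linear g -> (forall v w, f (tens v w) = g (tens v w)) ->
  f =1 g.
Proof.
move=> lf lg fg t; rewrite -[t]mreprK.
apply: (malg_lin_ext (f := f \o mproj tensor_submod)
  (g := g \o mproj tensor_submod)).
- by move=> a x y; rewrite /= linearP lf.
- by move=> a x y; rewrite /= linearP lg.
- by case=> v w; have := fg v w; rewrite tens.unlock.
Qed.

End TensorTheory.

Section NearlyFrobenius.
Variables (k : fieldType) (A : algType k).

Definition tens_mul : tensor A A -> A := tens_lift *%R.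

Definition tens_actl (a : A) : tensor A A -> tensor A A :=
  tens_lift (fun x y => tens (a * x) y).

Definition tens_actr (b : A) : tensor A A -> tensor A A :=
  tens_lift (fun x y => tens x (y * b)).

Lemma tens_mulE x y : tens_mul (tens x y) = x * y.
Proof.
by apply: tens_liftE => [w a u v|v a u w];
  rewrite ?mulrDl ?mulrDr -?scalerAl -?scalerAr.
Qed.

Lemma tens_actlE a x y : tens_actl a (tens x y) = tens (a * x) y.
Proof.
apply: tens_liftE => [w c u v|v c u w].
  by rewrite mulrDr -scalerAr tensDl tensZl.
by rewrite tensDr tensZr.
Qed.

Lemma tens_actrE b x y : tens_actr b (tens x y) = tens x (y * b).
Proof.
apply: tens_liftE => [w c u v|v c u w].
  by rewrite tensDl tensZl.
by rewrite mulrDl -scalerAl tensDr tensZr.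
Qed.

Definition nearly_frobenius (Delta : {linear A -> tensor A A}) : Prop :=
  forall a x b, Delta (a * x * b) = tens_actr b (tens_actl a (Delta x)).

Definition handle (Delta : {linear A -> tensor A A}) : A :=
  tens_mul (Delta 1).

End NearlyFrobenius.

(* Q_0 is nonempty, so that the unital algebra kQ is nonzero. *)
Record quiver := Quiver {
  vertex : finType;
  arrow : finType;
  src : arrow -> vertex;
  tgt : arrow -> vertex;
  vertex_nonempty : (0 < #|vertex|)%N
}.

Section QuiverTheory.
Variable Q : quiver.

Definition adjacent : rel (vertex Q) := fun x y =>
  [exists a : arrow Q, ((src a == x) && (tgt a == y)) ||
                       ((src a == y) && (tgt a == x))].

Definition quiver_connected : Prop := forall x y, connect adjacent x y.

Definition single_point : Prop := #|vertex Q| = 1%N /\ #|arrow Q| = 0%N.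

(* A path is its starting vertex with its sequence of arrows, so that the
   paths of length 0 are indexed by the vertices; arrows are composed from
   left to right: a1 a2 is a path when tgt a1 = src a2. *)
Fixpoint walk (x : vertex Q) (s : seq (arrow Q)) : bool :=
  if s is a :: s' then (src a == x) && walk (tgt a) s' else true.

Definition qpath := {p : vertex Q * seq (arrow Q) | walk p.1 p.2}.

HB.instance Definition _ := Choice.on qpath.

Implicit Types p q r : qpath.

Definition qsrc p : vertex Q := (val p).1.
Definition qarrows p : seq (arrow Q) := (val p).2.
Definition qtgt p : vertex Q := last (qsrc p) (map (@tgt Q) (qarrows p)).

Definition trivial_path (x : vertex Q) : qpath := Sub (x, [::]) isT.

Fact walk_arrow (a : arrow Q) : walk (src a) [:: a].
Proof. by rewrite /= eqxx. Qed.

Definition arrow_path (a : arrow Q) : qpath :=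
  Sub (src a, [:: a]) (walk_arrow a).

Lemma walk_cat x s t :
  walk x (s ++ t) = walk x s && walk (last x (map (@tgt Q) s)) t.
Proof. by elim: s x => //= a s IH x; rewrite IH andbA. Qed.

Fact qcat_subproof p q : qtgt p == qsrc q ->
  walk (qsrc p, qarrows p ++ qarrows q).1 (qsrc p, qarrows p ++ qarrows q).2.
Proof.
move=> /eqP e; rewrite /= walk_cat; apply/andP; split; first exact: valP p.
by rewrite -/(qtgt p) e; exact: valP q.
Qed.

Definition qcat p q : option qpath :=
  if boolP (qtgt p == qsrc q) is AltTrue e then
    Some (Sub (qsrc p, qarrows p ++ qarrows q) (qcat_subproof e))
  else None.

Lemma qcatP p q r : qcat p q = Some r <->
  qtgt p = qsrc q /\ val r = (qsrc p, qarrows p ++ qarrows q).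
Proof.
rewrite /qcat; case: {-}_ / boolP => [e|ne].
  split=> [[<-]|[_ er]]; first by rewrite (eqP e).
  by congr Some; apply: val_inj; rewrite er.
by split=> // -[e _]; rewrite e eqxx in ne.
Qed.

Lemma qcat_src p q r : qcat p q = Some r -> qsrc r = qsrc p.
Proof. by case/qcatP => _ e; rewrite /qsrc e. Qed.

Lemma qcat_tgt p q r : qcat p q = Some r -> qtgt r = qtgt q.
Proof.
case/qcatP => e er; rewrite /qtgt /qsrc /qarrows er /= map_cat last_cat.
by rewrite -/(qtgt p) e.
Qed.

Lemma qcatN p q : qcat p q = None <-> qtgt p <> qsrc q.
Proof.
rewrite /qcat; case: {-}_ / boolP => [e|ne]; last by split=> // _; apply/eqP.
by split=> // /(_ (eqP e)).
Qed.

Lemma qcatA p q r :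
  obind (qcat p) (qcat q r) = obind (qcat^~ r) (qcat p q).
Proof.
case eqr: (qcat q r) => [qr|]; case epq: (qcat p q) => [pq|] //=.
- have [e1 v1] := (qcatP _ _ _).1 eqr; have [e2 v2] := (qcatP _ _ _).1 epq.
  case er: (qcat pq r) => [s|].
    have [e3 v3] := (qcatP _ _ _).1 er; apply/qcatP.
    split; first by rewrite (qcat_src eqr).
    by rewrite v3 (qcat_src epq) /qarrows v1 v2 /= catA.
  by move/qcatN: er; rewrite (qcat_tgt epq).
- have [e1 _] := (qcatP _ _ _).1 eqr; apply/qcatN.
  by rewrite (qcat_src eqr); exact/qcatN.
- by apply/esym/qcatN; rewrite (qcat_tgt epq); exact/qcatN.
Qed.

Lemma qcat1p x p :
  qcat (trivial_path x) p = if x == qsrc p then Some p else None.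
Proof.
case: eqP => [->|ne]; last exact/qcatN.
by apply/qcatP; split=> //; case: p => -[].
Qed.

Lemma qcatp1 p x :
  qcat p (trivial_path x) = if x == qtgt p then Some p else None.
Proof.
case: eqP => [->|ne]; last by apply/qcatN => e; apply: ne.
by apply/qcatP; split=> //; rewrite cats0; case: p => -[].
Qed.

End QuiverTheory.

Definition pathalg (k : fieldType) (Q : quiver) := {malg k[qpath Q]}.

HB.instance Definition _ (k : fieldType) (Q : quiver) :=
  GRing.Lmodule.on (pathalg k Q).

HB.lock Definition pbasis (k : fieldType) (Q : quiver) (p : qpath Q) :
  pathalg k Q := << p >>.

Arguments pbasis {k Q} p.

Section PathAlgebra.
Variables (k : fieldType) (Q : quiver).
Local Notation pathalg := (pathalg k Q).

Lemma pbasisE (p q : qpath Q) : (pbasis p : pathalg)@_q = (p == q)%:R.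
Proof. by rewrite pbasis.unlock mcoeffU. Qed.

Lemma pathalg_lin_ext (V : lmodType k) (f g : pathalg -> V) :
  linear f -> linear g -> (forall p, f (pbasis p) = g (pbasis p)) -> f =1 g.
Proof.
by move=> lf lg fg; apply: malg_lin_ext => // p; have := fg p;
  rewrite pbasis.unlock.
Qed.

Definition pbasis_mul (p q : qpath Q) : pathalg :=
  if qcat p q is Some r then pbasis r else 0.

Definition pathalg_mul (f g : pathalg) : pathalg :=
  mextend (fun p => mextend (pbasis_mul p) g) f.

Definition pathalg_one : pathalg := \sum_(x : vertex Q) pbasis (trivial_path x).

Fact pathalg_mulU p q : pathalg_mul (pbasis p) (pbasis q) = pbasis_mul p q.
Proof. by rewrite /pathalg_mul pbasis.unlock !mextendU. Qed.

Fact pathalg_mul_linl g : linear (pathalg_mul^~ g).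
Proof. exact: mextend_is_linear. Qed.

Fact pathalg_mul_linr f : linear (pathalg_mul f).
Proof.
move=> a g h; rewrite /pathalg_mul /mextend scaler_sumr -big_split /=.
apply: eq_bigr => p _; rewrite -!/(mextend _ _) mextend_is_linear scalerDr.
by rewrite !scalerA mulrC.
Qed.

Fact pathalg_mulDl : left_distributive pathalg_mul +%R.
Proof.
by move=> f g h; have := pathalg_mul_linl h 1 f g; rewrite !scale1r.
Qed.

Fact pathalg_mulDr : right_distributive pathalg_mul +%R.
Proof.
by move=> h f g; have := pathalg_mul_linr h 1 f g; rewrite !scale1r.
Qed.

Fact pathalg_mul0l f : pathalg_mul 0 f = 0.
Proof. by rewrite /pathalg_mul linear0. Qed.

Fact pathalg_mul0r f : pathalg_mul f 0 = 0.
Proof.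
by have /eqP := pathalg_mulDr f 0 0; rewrite addr0 -subr_eq subrr => /eqP.
Qed.

Fact pathalg_mulA : associative pathalg_mul.
Proof.
have linr2 f g : linear (fun h => pathalg_mul f (pathalg_mul g h)).
  by move=> a x y; rewrite !pathalg_mul_linr.
move=> f g h; move: f; apply: pathalg_lin_ext => [||p].
- exact: pathalg_mul_linl.
- by move=> a x y; rewrite !pathalg_mul_linl.
move: g; apply: pathalg_lin_ext => [||q].
- by move=> a x y; rewrite pathalg_mul_linl pathalg_mul_linr.
- by move=> a x y; rewrite pathalg_mul_linr pathalg_mul_linl.
move: h; apply: pathalg_lin_ext => [||r].
- exact: linr2.
- exact: pathalg_mul_linr.
rewrite !pathalg_mulU /pbasis_mul.
have := qcatA p q r.
case: (qcat q r) => [qr|]; case: (qcat p q) => [pq|] /=;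
  rewrite ?pathalg_mulU /pbasis_mul ?pathalg_mul0l ?pathalg_mul0r => e //;
  by rewrite ?e // -e.
Qed.

Fact pathalg_mul1l : left_id pathalg_one pathalg_mul.
Proof.
apply: pathalg_lin_ext => [||p]; [exact: pathalg_mul_linr | by [] |].
rewrite /pathalg_one /pathalg_mul linear_sum /= (bigD1 (qsrc p)) //=.
rewrite -/(pathalg_mul _ (pbasis p)) pathalg_mulU /pbasis_mul qcat1p eqxx.
rewrite big1 ?addr0 // => x /negPf ne.
by rewrite -/(pathalg_mul _ (pbasis p)) pathalg_mulU /pbasis_mul qcat1p ne.
Qed.

Fact pathalg_mul1r : right_id pathalg_one pathalg_mul.
Proof.
apply: pathalg_lin_ext => [||p]; [exact: pathalg_mul_linl | by [] |].
rewrite /pathalg_one.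
rewrite (big_morph (pathalg_mul (pbasis p)) (pathalg_mulDr _)
  (pathalg_mul0r _)) (bigD1 (qtgt p)) //= pathalg_mulU /pbasis_mul qcatp1 eqxx.
rewrite big1 ?addr0 // => x /negPf ne.
by rewrite pathalg_mulU /pbasis_mul qcatp1 ne.
Qed.

Fact pathalg_oneE x : pathalg_one@_(trivial_path x) = 1.
Proof.
rewrite /pathalg_one raddf_sum /= (bigD1 x) //= pbasisE eqxx big1 ?addr0 //.
move=> y ne; rewrite pbasisE; case: eqP => // e.
by case: e ne => ->; rewrite eqxx.
Qed.

Fact pathalg_oner_neq0 : pathalg_one != 0.
Proof.
have /card_gt0P [x _] := vertex_nonempty Q.
apply/eqP => e; have := pathalg_oneE x; rewrite e mcoeff0.
by move/esym/eqP; rewrite oner_eq0.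
Qed.

HB.instance Definition _ := GRing.Zmodule_isNzRing.Build pathalg
  pathalg_mulA pathalg_mul1l pathalg_mul1r pathalg_mulDl pathalg_mulDr
  pathalg_oner_neq0.

Fact pathalg_scalerAl (a : k) (f g : pathalg) : a *: (f * g) = (a *: f) * g.
Proof. exact/esym/(scalable_linear (pathalg_mul_linl g)). Qed.

HB.instance Definition _ :=
  GRing.Lmodule_isLalgebra.Build k pathalg pathalg_scalerAl.

Fact pathalg_scalerAr (a : k) (f g : pathalg) : a *: (f * g) = f * (a *: g).
Proof. exact/esym/(scalable_linear (pathalg_mul_linr f)). Qed.

HB.instance Definition _ :=
  GRing.Lalgebra_isAlgebra.Build k pathalg pathalg_scalerAr.

Definition arrow_ideal : set pathalg :=
  ideal_gen [set f | exists a : arrow Q, f = pbasis (arrow_path a)].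

Definition admissible (I : set pathalg) : Prop :=
  two_sided_ideal I /\
  exists n, [/\ (2 <= n)%N, ideal_pow arrow_ideal n `<=` I
              & I `<=` ideal_pow arrow_ideal 2].

Definition no_const : set pathalg :=
  [set f | forall x, f@_(trivial_path x) = 0].

Lemma coef_trivial_mul (f g : pathalg) x :
  (f * g)@_(trivial_path x) = f@_(trivial_path x) * g@_(trivial_path x).
Proof.
pose c := fun h : pathalg => h@_(trivial_path x) : k^o.
have lc : linear c by move=> a u v; rewrite /c mcoeffD mcoeffZ.
rewrite -[LHS]/(c (f * g)) -[RHS]/(c f * c g).
move: f; apply: (@pathalg_lin_ext k^o (fun f => c (f * g))
  (fun f => c f * c g)) => [||p].
- by move=> a u v; rewrite mulrDl -scalerAl lc.
- by move=> a u v; rewrite lc mulrDl -scalerAl.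
move: g; apply: (@pathalg_lin_ext k^o (fun g => c (pbasis p * g))
  (fun g => c (pbasis p) * c g)) => [||q].
- by move=> a u v; rewrite mulrDr -scalerAr lc.
- by move=> a u v; rewrite lc mulrDr -scalerAr.
rewrite -[_ * _ in LHS]/(pathalg_mul (pbasis p) (pbasis q)) pathalg_mulU.
rewrite /pbasis_mul /c !pbasisE -natrM mulnb.
case E: (qcat p q) => [r|]; last first.
  rewrite mcoeff0; case: eqP => //= ep; case: eqP => //= eq.
  by move/qcatN: E; rewrite ep eq.
rewrite pbasisE; congr (_%:R); congr nat_of_bool.
have [e er] := (qcatP _ _ _).1 E.
apply/eqP/andP => [ex|[/eqP ep /eqP eq]]; last first.
  by apply: val_inj; rewrite er ep eq.
move: er; rewrite ex /=; case=> es; move/esym/nilP.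
rewrite /nilp size_cat addn_eq0 => /andP[/nilP ep /nilP eq].
have sp : qsrc p = x by rewrite -es.
have sq : qsrc q = x by rewrite -e /qtgt ep.
split; apply/eqP; apply: val_inj => /=.
  by rewrite [val p]surjective_pairing -/(qsrc p) -/(qarrows p) ep sp.
by rewrite [val q]surjective_pairing -/(qsrc q) -/(qarrows q) eq sq.
Qed.

Lemma no_const_ideal : two_sided_ideal no_const.
Proof.
split; first split.
- by move=> x; rewrite mcoeff0.
- by move=> f g ef eg x; rewrite mcoeffD ef eg addr0.
- by move=> f g eg x; rewrite coef_trivial_mul eg mulr0.
- by move=> f g ef x; rewrite coef_trivial_mul ef mul0r.
Qed.

Lemma arrow_ideal_no_const : arrow_ideal `<=` no_const.
Proof.
move=> f; apply; first exact: no_const_ideal.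
by move=> _ [a ->] x; rewrite pbasisE; case: eqP => // -[].
Qed.

Fact admissible_proper I : admissible I -> ~ I 1.
Proof.
move=> [_ [n [_ _ sub]]] /sub [s [ins e]].
have /card_gt0P [x _] := vertex_nonempty Q.
have := pathalg_oneE x; rewrite -[pathalg_one]/(1 : pathalg) e.
rewrite raddf_sum /= big_seq big1 => [/esym/eqP|p /ins[_ Jp]].
  by rewrite oner_eq0.
by rewrite coef_trivial_mul (arrow_ideal_no_const Jp) mulr0.
Qed.

Definition admissible_ideal (I : set pathalg) (hI : admissible I) :
    proper_ideal2 pathalg :=
  ProperIdeal2 hI.1 (admissible_proper hI).

Definition bound_quiver_algebra (I : set pathalg) (hI : admissible I) :
    algType k :=
  aquot (admissible_ideal hI).

End PathAlgebra.

(* Main.v *)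
(** Write [t = Delta 1], so that [a t = t a] for every [a] in [A].  Since [I]
    lies in [F^2], the coefficients [eps_x] at the vertices and [alpha_a] at the
    arrows are well-defined linear forms on [A]; the [eps_x] are multiplicative,
    and [alpha_a (u v) = eps_x u * alpha_a v + alpha_a u * eps_y v] for an arrow
    [a : x -> y].  Applying [eps_x (x) alpha_a], resp. [alpha_a (x) eps_y], to
    [a t = t a] shows that [(eps_x (x) eps_x) t = 0 = (eps_y (x) eps_y) t].  But
    [(eps_x (x) eps_x) t = eps_x omega], and every vertex is an end of some
    arrow, so [omega] lies in the image of [F], which is a nilpotent ideal. *)
Require Import Defs.
From mathcomp Require Import all_boot all_algebra.
From mathcomp Require Import finmap monalg.
From mathcomp Require Import boolp classical_sets.

Set Implicit Arguments.
Unset Strict Implicit.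
Unset Printing Implicit Defensive.

Import GRing.Theory.

Local Open Scope classical_set_scope.
Local Open Scope ring_scope.

(** * Nil left multiples and powers of ideals *)

(** If a maximal left ideal [M] misses [w], then [M + A w] contains [1], so [M] contains some
    [1 - b * w], a unit because [b * w] is nilpotent. *)
Lemma nil_left_multiples_jacobson (k : fieldType) (A : algType k) (w : A) :
  (forall a, exists n, (a * w) ^+ n = 0) -> jacobson_radical A w.
Proof.
move=> nilw M [[M0 MD MM] MT Mmax].
have [//|Mw] := pselect (M w); exfalso.
pose N := [set z | exists m b, M m /\ z = m + b * w].
have Nl : left_ideal N.
  split.
  - by exists 0, 0; rewrite mul0r addr0.
  - move=> _ _ [m [b [Mm ->]]] [m' [b' [Mm' ->]]].
    by exists (m + m'), (b + b'); split; [exact: MD | rewrite mulrDl addrACA].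
  - move=> a _ [m [b [Mm ->]]]; exists (a * m), (a * b).
    by split; [exact: MM | rewrite mulrDr mulrA].
have MN : M `<=` N by move=> m Mm; exists m, 0; rewrite mul0r addr0.
case: (Mmax N Nl MN) => [eNM|eNT].
  by apply: Mw; rewrite -eNM; exists 0, 1; rewrite add0r mul1r.
have [m [b [Mm e1]]] : N 1 by rewrite eNT.
have [n bwn] := nilw b.
have em : m = 1 - b * w by rewrite e1 addrK.
have M1 : M 1.
  have := subrXX_comm n (commr_sym (commr1 (b * w))).
  rewrite expr1n bwn subr0 => ->; rewrite -em.
  (* [M] is only a left ideal, so the geometric sum, inverse to [m], is moved to the left of [m]. *)
  have -> : m * (\sum_(i < n) 1 ^+ (n.-1 - i) * (b * w) ^+ i) =
            (\sum_(i < n) 1 ^+ (n.-1 - i) * (b * w) ^+ i) * m.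
    rewrite em; apply: commr_sym; apply: commrB; first exact: commr1.
    apply: commr_sym; apply: commr_sum => i _; rewrite expr1n mul1r.
    exact: commrX.
  exact: MM.
by apply: MT; apply/seteqP; split=> // z _; rewrite -[z]mulr1; exact: MM.
Qed.

Lemma ideal_pow_expr (k : fieldType) (A : algType k) (I : set A) f n :
  I f -> ideal_pow I n (f ^+ n).
Proof.
move=> If; elim: n => [|n IHn] //=.
exists [:: (f ^+ n, f)]; split=> [p|]; last by rewrite big_seq1 exprSr.
by rewrite inE => /eqP ->.
Qed.

(** [K] absorbs left multiplication, so a right factor in [K] puts each product in [K]. *)
Lemma sub_ideal_mul (k : fieldType) (A : algType k) (I J K : set A) :
  two_sided_ideal K -> J `<=` K -> ideal_mul I J `<=` K.
Proof.
move=> [[K0 KD KM] _] JK _ [s [sIJ ->]]; rewrite big_seq.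
apply: big_ind => // p /sIJ[_ /JK]; exact: KM.
Qed.

(** * Linear forms on the tensor square *)

Section TensorForm.
Variables (k : fieldType) (A : algType k).
Implicit Types phi psi : A -> k^o.

(** Bare functions as arguments let translates such as [fun u => phi (a * u)] be plugged in and
    rewritten by extensionality. *)
Definition tens_form phi psi : tensor A A -> k^o :=
  tens_lift (fun u v => phi u * psi v).

Lemma tens_formE phi psi u v : linear phi -> linear psi ->
  tens_form phi psi (tens u v) = phi u * psi v.
Proof.
move=> lphi lpsi; apply: (@tens_liftE _ _ _ _ (fun u v => phi u * psi v : k^o)).
  by move=> w a x y; rewrite lphi mulrDl -scalerAl.
by move=> w a x y; rewrite lpsi mulrDr -scalerAr.
Qed.

Lemma tens_form_linear phi psi : linear phi -> linear psi ->
  linear (tens_form phi psi).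
Proof.
move=> lphi lpsi; apply: tens_lift_linear.
  by move=> w a x y; rewrite lphi mulrDl -scalerAl.
by move=> w a x y; rewrite lpsi mulrDr -scalerAr.
Qed.

Lemma tens_mul_linear : linear (@tens_mul k A).
Proof.
apply: tens_lift_linear => w a x y.
  by rewrite mulrDl -scalerAl.
by rewrite mulrDr -scalerAr.
Qed.

Lemma tens_actl_linear a : linear (@tens_actl k A a).
Proof.
apply: tens_lift_linear => w c x y.
  by rewrite mulrDr -scalerAr tensDl tensZl.
by rewrite tensDr tensZr.
Qed.

Lemma tens_actr_linear a : linear (@tens_actr k A a).
Proof.
apply: tens_lift_linear => w c x y.
  by rewrite tensDl tensZl.
by rewrite mulrDl -scalerAl tensDr tensZr.
Qed.

(** A multiplicative [phi] makes the form factor through the multiplication of [A]; this brings in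
    the handle. *)
Lemma tens_form_mul phi t : linear phi -> {morph phi : u v / u * v} ->
  tens_form phi phi t = phi (tens_mul t).
Proof.
move=> lphi mphi; move: t; apply: tens_lin_ext.
- exact: tens_form_linear.
- by move=> a x y; rewrite tens_mul_linear lphi.
- by move=> v w; rewrite tens_formE // tens_mulE mphi.
Qed.

Lemma tens_form_act phi psi a b t : linear phi -> linear psi ->
  tens_form phi psi (tens_actr b (tens_actl a t)) =
  tens_form (fun u => phi (a * u)) (fun v => psi (v * b)) t.
Proof.
move=> lphi lpsi.
have lphia : linear (fun u => phi (a * u)).
  by move=> c x y; rewrite mulrDr -scalerAr lphi.
have lpsib : linear (fun v => psi (v * b)).
  by move=> c x y; rewrite mulrDl -scalerAl lpsi.
move: t; apply: tens_lin_ext.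
- by move=> c x y; rewrite tens_actl_linear tens_actr_linear tens_form_linear.
- exact: tens_form_linear.
- by move=> v w; rewrite tens_actlE tens_actrE !tens_formE.
Qed.

(** Both sides evaluate [tens_form phi psi] at [Delta a], which is [Delta 1] acted on by [a] from
    the left or from the right. *)
Lemma nearly_frobenius_form (Delta : {linear A -> tensor A A}) phi psi a :
  nearly_frobenius Delta -> linear phi -> linear psi ->
  tens_form (fun u => phi (a * u)) psi (Delta 1) =
  tens_form phi (fun v => psi (v * a)) (Delta 1).
Proof.
move=> nF lphi lpsi.
have := nF 1 1 a; have := nF a 1 1.
rewrite !mulr1 !mul1r => -> /(congr1 (tens_form phi psi)).
rewrite !tens_form_act //.
have -> : (fun v => psi (v * 1)) = psi by apply/funext => v; rewrite mulr1.
by have -> : (fun u => phi (1 * u)) = phi by apply/funext => u; rewrite mul1r.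
Qed.

Lemma tens_form0l psi t : linear psi -> tens_form (fun=> 0) psi t = 0.
Proof.
move=> lpsi; have l0 : linear (fun _ : A => 0 : k^o).
  by move=> c x y; rewrite scaler0 addr0.
move: t; apply: tens_lin_ext; first exact: tens_form_linear.
  by move=> c x y; rewrite scaler0 addr0.
by move=> v w; rewrite tens_formE // mul0r.
Qed.

Lemma tens_form0r phi t : linear phi -> tens_form phi (fun=> 0) t = 0.
Proof.
move=> lphi; have l0 : linear (fun _ : A => 0 : k^o).
  by move=> c x y; rewrite scaler0 addr0.
move: t; apply: tens_lin_ext; first exact: tens_form_linear.
  by move=> c x y; rewrite scaler0 addr0.
by move=> v w; rewrite tens_formE // mulr0.
Qed.

(** In [nearly_frobenius_form] the left side vanishes and the right side becomes
    [tens_form phi phi (Delta 1)]. Used at the source of an arrow. *)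
Lemma handle_form0l (Delta : {linear A -> tensor A A}) phi psi a :
  nearly_frobenius Delta -> linear phi -> linear psi ->
  {morph phi : u v / u * v} -> (forall u, phi (a * u) = 0) ->
  (forall v, psi (v * a) = phi v) -> phi (handle Delta) = 0.
Proof.
move=> nF lphi lpsi mphi phi0 psiE.
have := nearly_frobenius_form a nF lphi lpsi.
rewrite (funext phi0) (funext psiE) tens_form0l // => ->.
by rewrite tens_form_mul.
Qed.

(** The mirror image, with the tensor factors exchanged, for the target of an arrow. *)
Lemma handle_form0r (Delta : {linear A -> tensor A A}) phi psi a :
  nearly_frobenius Delta -> linear phi -> linear psi ->
  {morph phi : u v / u * v} -> (forall v, phi (v * a) = 0) ->
  (forall u, psi (a * u) = phi u) -> phi (handle Delta) = 0.
Proof.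
move=> nF lphi lpsi mphi phi0 psiE.
have := nearly_frobenius_form a nF lpsi lphi.
rewrite (funext phi0) (funext psiE) tens_form0r // => <-.
by rewrite tens_form_mul.
Qed.

End TensorForm.

(** * Coefficients at paths of length at most one *)

Section PathCoefficients.
Variables (k : fieldType) (Q : quiver).
Implicit Types (f g : pathalg k Q) (a : arrow Q) (x : vertex Q) (p q : qpath Q).

Lemma trivial_pathE p : qarrows p = [::] -> p = trivial_path (qsrc p).
Proof.
by case: p => -[x s] w /= e; apply: val_inj; rewrite /= -e.
Qed.

Lemma arrow_path_neq_trivial a x : arrow_path a != trivial_path x.
Proof. by apply/eqP => -[]. Qed.

(** By bilinearity [f] and [g] may be taken to be paths; an arrow factors only with the trivial path
    at its source on the left or at its target on the right. *)
Lemma coef_arrow_mul f g a :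
  (f * g)@_(arrow_path a) =
  f@_(trivial_path (src a)) * g@_(arrow_path a) +
  f@_(arrow_path a) * g@_(trivial_path (tgt a)).
Proof.
pose c p (h : pathalg k Q) := h@_p : k^o.
have lc p : linear (c p) by move=> b u v; rewrite /c mcoeffD mcoeffZ.
pose e := trivial_path (src a); pose e' := trivial_path (tgt a).
pose al := arrow_path a.
rewrite -[LHS]/(c al (f * g)) -[RHS]/(c e f * c al g + c al f * c e' g).
move: f; apply: (@pathalg_lin_ext k Q k^o (fun f => c al (f * g))
  (fun f => c e f * c al g + c al f * c e' g)) => [||p].
- by move=> b u v; rewrite mulrDl -scalerAl lc.
- move=> b u v; rewrite !lc !mulrDl -!scalerAl scalerDr !addrA.
  by congr (_ + _); rewrite addrAC.
move: g; apply: (@pathalg_lin_ext k Q k^o (fun g => c al (pbasis p * g))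
  (fun g => c e (pbasis p) * c al g + c al (pbasis p) * c e' g)) => [||q].
- by move=> b u v; rewrite mulrDr -scalerAr lc.
- move=> b u v; rewrite !lc !mulrDr -!scalerAr scalerDr !addrA.
  by congr (_ + _); rewrite addrAC.
rewrite -[_ * _ in LHS]/(pathalg_mul (pbasis p) (pbasis q)) pathalg_mulU.
rewrite /pbasis_mul /c !pbasisE -!natrM !mulnb -natrD.
case ep: (qarrows p) => [|b s].
  rewrite (trivial_pathE ep) qcat1p.
  have -> : (trivial_path (qsrc p) == al) = false by apply/eqP.
  rewrite /= addn0.
  have [->|neq] := eqVneq q al.
    rewrite andbT; case: eqP => [qx|ne]; first by rewrite pbasisE qx !eqxx.
    by rewrite mcoeff0; case: eqP => // -[].
  by rewrite andbF; case: ifP => _; rewrite ?mcoeff0 // pbasisE (negPf neq).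
have -> : (p == e) = false by apply/eqP => pe; rewrite pe in ep.
rewrite add0n; case eq: (qarrows q) => [|b' s'].
  rewrite (trivial_pathE eq) qcatp1.
  have [->|neq] := eqVneq p al.
    rewrite /=; case: eqP => [qx|ne]; first by rewrite pbasisE qx !eqxx.
    by rewrite mcoeff0; case: eqP => // -[].
  by rewrite /=; case: ifP => _; rewrite ?mcoeff0 // pbasisE (negPf neq).
have -> : (q == e') = false by apply/eqP => qe; rewrite qe in eq.
(* Neither path is trivial here, so a concatenation has length at least two. *)
rewrite andbF; case E: (qcat p q) => [r|]; last by rewrite mcoeff0.
have [_ er] := (qcatP _ _ _).1 E.
rewrite pbasisE; case: eqP => // ra; move: er; rewrite ra ep eq => -[_ _].
by case: s {ep}.
Qed.

(** Split off the first arrow; the ideal absorbs the rest. *)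
Lemma path_arrow_ideal p :
  qarrows p != [::] -> arrow_ideal (pbasis p : pathalg k Q).
Proof.
case: p => -[x [|a s]] //= wp _; set p := exist _ _ _.
have /andP[/eqP sa ws] := wp.
pose q : qpath Q := Sub (tgt a, s) ws.
have E : qcat (arrow_path a) q = Some p by apply/qcatP; rewrite /qsrc /= sa.
have -> : pbasis p = pbasis (arrow_path a) * pbasis q :> pathalg k Q.
  rewrite -[RHS]/(pathalg_mul (pbasis (arrow_path a)) (pbasis q)).
  by rewrite pathalg_mulU /pbasis_mul E.
have [_ IM] := ideal_gen_ideal
  [set f : pathalg k Q | exists a : arrow Q, f = pbasis (arrow_path a)].
by apply: IM => J _; apply; exists a.
Qed.

(** Converse of [arrow_ideal_no_const]: in the path expansion of [f] only nontrivial paths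
    survive. *)
Lemma no_const_arrow_ideal f : no_const f -> arrow_ideal f.
Proof.
move=> nf; have id := ideal_gen_ideal
  [set f : pathalg k Q | exists a : arrow Q, f = pbasis (arrow_path a)].
rewrite [f]monalgE; apply: big_ind => [|u v|p _].
- exact: (ideal_submod0 id).
- exact: (ideal_submodD id).
rewrite malg_scaleU.
have [ep|np] := eqVneq (qarrows p) [::].
  rewrite [p]trivial_pathE // nf scale0r; exact: (ideal_submod0 id).
apply: (ideal_submodZ id); rewrite (_ : << p >> = pbasis p).
  exact: path_arrow_ideal.
by rewrite pbasis.unlock.
Qed.

(** Each term of [coef_arrow_mul] contains a trivial-path coefficient of a factor, and these vanish
    on the arrow ideal. *)
Lemma arrow_ideal_sq_coef f : ideal_pow (@arrow_ideal k Q) 2 f ->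
  no_const f /\ forall a, f@_(arrow_path a) = 0.
Proof.
move=> F2f; split.
  by apply: sub_ideal_mul F2f; [exact: no_const_ideal | exact: arrow_ideal_no_const].
move=> a; case: F2f => s [sF ->].
rewrite raddf_sum /= big_seq big1 // => p /sF[F1 F2].
rewrite coef_arrow_mul (arrow_ideal_no_const F2) mulr0 addr0.
(* [ideal_pow] starts from [setT], so [p.1] is a sum of products whose right factors are in the
   arrow ideal. *)
have nc : no_const p.1.
  by apply: sub_ideal_mul F1; [exact: no_const_ideal | exact: arrow_ideal_no_const].
by rewrite nc mul0r.
Qed.

End PathCoefficients.

(** * Coefficient forms on the bound quiver algebra *)

Section BoundQuiverAlgebra.
Variables (k : fieldType) (Q : quiver) (I : set (pathalg k Q)).
Variable I_adm : admissible I.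
Local Notation A := (bound_quiver_algebra I_adm).
Local Notation proj := (aproj (admissible_ideal I_adm)).

(* A linear form only for paths of length at most 1: the coefficients at longer
   paths depend on the representative. *)
Definition qcoef (p : qpath Q) (u : A) : k^o := (arepr u)@_p.

(** Two representatives differ by an element of [I], hence of the square of the arrow ideal, where
    these coefficients vanish. *)
Lemma qcoefE p f : (size (qarrows p) <= 1)%N -> qcoef p (proj f) = f@_p.
Proof.
move=> sp; have [_ [_ [_ _ subI]]] := I_adm.
have /subI/arrow_ideal_sq_coef[nc na] : I (arepr (proj f) - f).
  by apply/(@aproj_eq _ _ (admissible_ideal I_adm)); exact: areprK.
apply/eqP; rewrite -subr_eq0 -mcoeffB; apply/eqP.
case: p sp => -[x [|a [|//]]] /= wp _.
  by have := nc x; congr (_@__ = 0); exact: val_inj.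
have := na a; congr (_@__ = 0); apply: val_inj => /=.
by move: wp; rewrite andbT => /eqP ->.
Qed.

Lemma qcoef_linear p : (size (qarrows p) <= 1)%N -> linear (qcoef p).
Proof.
move=> sp a u v; rewrite -[u]areprK -[v]areprK -linearP !qcoefE //.
by rewrite mcoeffD mcoeffZ.
Qed.

Lemma aquot_mul_reprE (u v : A) :
  u * v = proj ((arepr u : pathalg k Q) * (arepr v : pathalg k Q)).
Proof. by []. Qed.

Lemma qcoef_trivial_mul x : {morph qcoef (trivial_path x) : u v / u * v}.
Proof.
by move=> u v; rewrite aquot_mul_reprE qcoefE // coef_trivial_mul.
Qed.

Lemma qcoef_arrow_mul a u v :
  qcoef (arrow_path a) (u * v) =
  qcoef (trivial_path (src a)) u * qcoef (arrow_path a) v +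
  qcoef (arrow_path a) u * qcoef (trivial_path (tgt a)) v.
Proof.
by rewrite aquot_mul_reprE qcoefE // coef_arrow_mul.
Qed.

(** Any [b * w] has a representative in the arrow ideal, some power of which lies in [I]; so [b * w]
    is nilpotent. *)
Lemma qcoef_jacobson w :
  (forall x, qcoef (trivial_path x) w = 0) -> jacobson_radical A w.
Proof.
move=> w0; apply: nil_left_multiples_jacobson => b.
have [_ [n [_ subF _]]] := I_adm; exists n.
rewrite aquot_mul_reprE -rmorphXn.
rewrite -(raddf0 proj); apply/aproj_eq; rewrite subr0; apply: subF.
apply: ideal_pow_expr; apply: no_const_arrow_ideal => x.
by rewrite coef_trivial_mul [X in _ * X]w0 mulr0.
Qed.

Variable Delta : {linear A -> tensor A A}.
Hypothesis Delta_nF : nearly_frobenius Delta.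

(** Multiplying by the arrow on the right turns its own coefficient form into the one at its
    source. *)
Lemma handle_coef_src a : qcoef (trivial_path (src a)) (handle Delta) = 0.
Proof.
apply: (@handle_form0l _ _ _ _ (qcoef (arrow_path a))
  (proj (pbasis (arrow_path a)))) => //.
- exact: qcoef_linear.
- exact: qcoef_linear.
- exact: qcoef_trivial_mul.
- move=> u; rewrite qcoef_trivial_mul qcoefE // pbasisE.
  by rewrite (negPf (arrow_path_neq_trivial _ _)) mul0r.
- move=> v; rewrite qcoef_arrow_mul !qcoefE // !pbasisE eqxx mulr1.
  by rewrite (negPf (arrow_path_neq_trivial _ _)) mulr0 addr0.
Qed.

(** Multiplying by the arrow on the left gives the form at its target. *)
Lemma handle_coef_tgt a : qcoef (trivial_path (tgt a)) (handle Delta) = 0.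
Proof.
apply: (@handle_form0r _ _ _ _ (qcoef (arrow_path a))
  (proj (pbasis (arrow_path a)))) => //.
- exact: qcoef_linear.
- exact: qcoef_linear.
- exact: qcoef_trivial_mul.
- move=> v; rewrite qcoef_trivial_mul [X in _ * X]qcoefE // pbasisE.
  by rewrite (negPf (arrow_path_neq_trivial _ _)) mulr0.
- move=> u; rewrite qcoef_arrow_mul !qcoefE // !pbasisE eqxx mul1r.
  by rewrite (negPf (arrow_path_neq_trivial _ _)) mul0r add0r.
Qed.

End BoundQuiverAlgebra.

(** * Every vertex is an end of an arrow *)

Lemma connected_vertex_arrow (Q : quiver) (x : vertex Q) :
  quiver_connected Q -> ~ single_point Q ->
  exists a : arrow Q, src a = x \/ tgt a = x.
Proof.
move=> Qc Qn; apply: contrapT => noa; apply: Qn.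
(* A nonempty chain from [x] to [y] would begin with an arrow at [x]. *)
have eqx y : y = x.
  case/connectP: (Qc x y) => -[|z s] //= /andP[/existsP[a axz] _] _.
  case: noa; exists a.
  by case/orP: axz => /andP[/eqP sa /eqP ta]; [left | right].
split; first by apply: (@eq_card1 _ x) => y; rewrite [y]eqx !inE eqxx.
by apply: eq_card0 => a; case: noa; exists a; left.
Qed.

Theorem proposition3p10 (k : closedFieldType) (Q : quiver)
  (Q_connected : quiver_connected Q) (Q_not_point : ~ single_point Q)
  (I : set (pathalg k Q)) (I_adm : admissible I)
  (Delta : {linear bound_quiver_algebra I_adm ->
     tensor (bound_quiver_algebra I_adm) (bound_quiver_algebra I_adm)})
  (Delta_nF : nearly_frobenius Delta) :
  jacobson_radical (bound_quiver_algebra I_adm) (handle Delta).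
Proof.
apply: qcoef_jacobson => x.
have [a [<-|<-]] := connected_vertex_arrow x Q_connected Q_not_point.
  exact: handle_coef_src.
exact: handle_coef_tgt.
Qed.
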